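(* Let $K$ be a number field of degree $n$ over $\mathbb{Q}$ and let $\Delta(u_1,\dots,u_n)$ be the primitive form whose square is the discriminant of the fundamental equation of $K$ freed from its numerical factor. Let $\Gamma$ be a number field, let $p\mathcal{O}_\Gamma=\mathfrak{p}_1^{\epsilon_1}\mathfrak{p}_2^{\epsilon_2}\cdots\mathfrak{p}_l^{\epsilon_l}$ be the decomposition of a rational prime $p$ into powers of distinct prime ideals in $\Gamma$, and let $k_1,k_2,\dots,k_\lambda$ be the distinct values among the residual degrees of $\mathfrak{p}_1,\dots,\mathfrak{p}_l$. Then $\Gamma$ is a supplementary domain for $K$ with respect to $p$ if and only if $\Delta(u_1,\dots,u_n)$ does not contain any of the $\lambda$ divisor systems $$P_{k_1},P_{k_2},\dots,P_{k_\lambda}.$$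
   Context: Let $\xi_1,\dots,\xi_n$ be an integral basis of the ring of integers of $K$, $u_1,\dots,u_n$ indeterminates, $w_0=u_1\xi_1+\cdots+u_n\xi_n$ the fundamental form and $w_0,\dots,w_{n-1}$ its conjugates (replace the $\xi_i$ by their conjugates under the $n$ embeddings of $K$). The discriminant of the fundamental equation $\prod_j(w-w_j)=0$ is $\Delta(u_1,\dots,u_n)^2\cdot D$, where $D$ is the discriminant of $K$ (the numerical factor) and $\Delta$ is a homogeneous polynomial of degree $\frac{n(n-1)}2$ with integer coefficients having no common divisor (defined up to sign). For a number field $\Gamma$ with ring of integers $\mathcal{O}_\Gamma$, $\Gamma$ is a supplementary domain for $K$ with respect to the prime $p$ if values $a_1,\dots,a_n\in\mathcal{O}_\Gamma$ can be chosen for $u_1,\dots,u_n$ so that the discriminant $\Delta(a_1,\dots,a_n)^2D$ contains $p$ no more than the discriminant $D$ of $K$ does; equivalently, so that $\Delta(a_1,\dots,a_n)$ is coprime to $p$ in $\mathcal{O}_\Gamma$ (lies in no prime ideal dividing $p$). For $k\ge1$, $P_k=(p;\,u_1^{p^k}-u_1,\dots,u_n^{p^k}-u_n)$. A polynomial in $\mathbb{Z}[u_1,\dots,u_n]$ contains the divisor system $P_k$ if it lies in the ideal of $\mathbb{Z}[u_1,\dots,u_n]$ generated by $p,\,u_1^{p^k}-u_1,\dots,u_n^{p^k}-u_n$. *)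

(* Defs.v *)
From HB Require Import structures.
From mathcomp Require Import all_boot all_order all_algebra all_field.
From mathcomp Require Import mpoly.

Set Implicit Arguments.
Unset Strict Implicit.
Unset Printing Implicit Defensive.

Import Order.TTheory GRing.Theory Num.Theory.
Local Open Scope ring_scope.

(* A number field is a [L : fieldExtType rat]; its ring of integers and the
   ideals of that ring are handled as predicates on L. *)

Definition is_alg_int (L : fieldExtType rat) (x : L) : Prop :=
  integralOver (intr : int -> L) x.

Definition is_ideal (L : fieldExtType rat) (I : L -> Prop) : Prop :=
  [/\ forall x, I x -> is_alg_int x,
      I 0,
      forall x y, I x -> I y -> I (x + y)
    & forall a x, is_alg_int a -> I x -> I (a * x)].

Definition is_prime_ideal (L : fieldExtType rat) (I : L -> Prop) : Prop :=
  [/\ is_ideal I,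
      ~ I 1
    & forall x y, is_alg_int x -> is_alg_int y -> I (x * y) -> I x \/ I y].

Definition eq_ideal (L : fieldExtType rat) (I J : L -> Prop) : Prop :=
  forall x, I x <-> J x.

Definition principal_ideal (L : fieldExtType rat) (c : L) : L -> Prop :=
  fun x => exists2 y, is_alg_int y & x = c * y.

Definition ideal_mul (L : fieldExtType rat) (I J : L -> Prop) : L -> Prop :=
  fun x => exists (m : nat) (a b : 'I_m -> L),
    [/\ forall i, I (a i), forall i, J (b i) & x = \sum_(i < m) a i * b i].

Definition ideal_exp (L : fieldExtType rat) (I : L -> Prop) (m : nat) :
  L -> Prop := iter m (ideal_mul I) (@is_alg_int L).

(* The quotient of the ring of integers of L by I has an F_p-basis of k
   elements, the classes of b_0, ..., b_(k-1). *)
Definition residual_degree (L : fieldExtType rat) (p : nat) (I : L -> Prop)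
  (k : nat) : Prop :=
  exists b : 'I_k -> L,
    [/\ forall i, is_alg_int (b i),
        forall x, is_alg_int x ->
          exists c : 'I_k -> int, I (x - \sum_(i < k) (c i)%:~R * b i)
      & forall c : 'I_k -> int,
          I (\sum_(i < k) (c i)%:~R * b i) -> forall i, (p%:Z %| c i)%Z].

(* p O = P_0 ^ e_0 * ... * P_(l-1) ^ e_(l-1), with distinct prime ideals. *)
Definition prime_ideal_decomposition (L : fieldExtType rat) (p l : nat)
  (P : 'I_l -> L -> Prop) (e : 'I_l -> nat) : Prop :=
  [/\ forall i, is_prime_ideal (P i),
      forall i j, eq_ideal (P i) (P j) -> i = j,
      forall i, (0 < e i)%N
    & eq_ideal (principal_ideal p%:R)
        (\big[@ideal_mul L/@is_alg_int L]_(i < l) ideal_exp (P i) (e i))].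

Definition is_integral_basis (L : fieldExtType rat) (n : nat) (xi : 'I_n -> L)
  : Prop :=
  [/\ forall i, is_alg_int (xi i),
      forall x, is_alg_int x ->
        exists c : 'I_n -> int, x = \sum_(i < n) (c i)%:~R * xi i
    & forall c : 'I_n -> int,
        \sum_(i < n) (c i)%:~R * xi i = 0 -> forall i, c i = 0].

(* Embeddings into algC exhaust the complex ones, since a number field is
   algebraic over rat. *)
Definition enumerates_embeddings (L : fieldExtType rat) (n : nat)
  (sigma : 'I_n -> {rmorphism L -> algC}) : Prop :=
  (forall i j, sigma i =1 sigma j -> i = j) /\
  (forall f : {rmorphism L -> algC}, exists i, f =1 sigma i).

Definition is_field_discriminant (L : fieldExtType rat) (n : nat)
  (sigma : 'I_n -> {rmorphism L -> algC}) (xi : 'I_n -> L) (D : int) : Prop :=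
  D%:~R = (\det (\matrix_(i < n, j < n) sigma i (xi j))) ^+ 2.

Definition conj_fundamental_form (L : fieldExtType rat) (n : nat)
  (sigma : 'I_n -> {rmorphism L -> algC}) (xi : 'I_n -> L) (i : 'I_n) :
  {mpoly algC[n]} := \sum_(j < n) sigma i (xi j) *: 'X_j.

(* The discriminant of the polynomial \prod_i (w - w_i) in w. *)
Definition fundamental_discriminant (L : fieldExtType rat) (n : nat)
  (sigma : 'I_n -> {rmorphism L -> algC}) (xi : 'I_n -> L) : {mpoly algC[n]} :=
  \prod_(i < n) \prod_(j < n | (i < j)%N)
    (conj_fundamental_form sigma xi i - conj_fundamental_form sigma xi j) ^+ 2.

Definition is_primitive_mpoly (n : nat) (F : {mpoly int[n]}) : Prop :=
  forall d : int, (forall m, (d %| F@_m)%Z) -> (d %| 1)%Z.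

Definition is_primitive_discriminant_form (L : fieldExtType rat) (n : nat)
  (sigma : 'I_n -> {rmorphism L -> algC}) (xi : 'I_n -> L) (D : int)
  (Delta : {mpoly int[n]}) : Prop :=
  [/\ Delta \is 'C(n, 2).-homog,
      is_primitive_mpoly Delta
    & fundamental_discriminant sigma xi
        = map_mpoly (intr : int -> algC) (Delta ^+ 2 * D%:MP)].

(* "Contains p no more than": at every prime ideal above p, the discriminant
   Delta(a)^2 * D is divisible by no higher power of that ideal than D is. *)
Definition supplementary_domain (L : fieldExtType rat) (p n : nat)
  (Delta : {mpoly int[n]}) (D : int) : Prop :=
  exists a : 'I_n -> L,
    (forall i, is_alg_int (a i)) /\
    (forall I : L -> Prop, is_prime_ideal I -> I p%:R ->
       forall m : nat,
         ideal_exp I m ((mmap (intr : int -> L) a Delta) ^+ 2 * D%:~R) ->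
         ideal_exp I m D%:~R).

(* Membership of F in the ideal (p; u_1^(p^k) - u_1, ..., u_n^(p^k) - u_n). *)
Definition contains_divisor_system (p k n : nat) (F : {mpoly int[n]}) : Prop :=
  exists (G : {mpoly int[n]}) (H : 'I_n -> {mpoly int[n]}),
    F = p%:R * G + \sum_(i < n) H i * ('X_i ^+ (p ^ k) - 'X_i).

(* Main.v *)
Require Import Defs.
From HB Require Import structures.
From mathcomp Require Import all_boot all_order all_algebra all_field.
From mathcomp Require Import mpoly.
From mathcomp Require Import ring zify.
From Stdlib Require Import Classical.

Set Implicit Arguments.
Unset Strict Implicit.
Unset Printing Implicit Defensive.

Import Order.TTheory GRing.Theory Num.Theory.
Local Open Scope ring_scope.

(** Write O for the ring of integers of Gamma. Three reductions bring the
    statement down to polynomials over a finite field.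

    First, being supplementary means that some integral point a makes Delta(a)
    avoid every prime above p ([supplementary_coprime]). If Delta(a) avoids a
    prime I, it is invertible modulo every power of I, so the factor Delta(a)^2
    cannot raise the power of I that divides D. If Delta(a) lies in I, then
    from D in I^m one gets Delta(a)^2 D in I^(m+1), hence D in I^(m+1) by
    the condition, and so D would lie in all powers of I; the decomposition of
    p allows this only for D = 0 ([int_not_in_all_powers]). And D is not zero
    because distinct embeddings give distinct conjugates of the fundamental
    form ([discriminant_neq0]).

    Second, the Chinese remainder theorem lets the point a be chosen separately
    at each prime above p ([coprime_value_local]).

    Third, at a prime I of residual degree k, put q = p^k; then O/I is a field
    with q elements, and an integral polynomial F vanishes at all points of
    O/I exactly when F lies in (p, u_1^q - u_1, ..., u_n^q - u_n). One
    direction is Fermat's little theorem ([residue_expr_card]). For the other,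
    reduce F to degree less than q in each variable ([reduced_form_exists]);
    interpolation then recovers each coefficient from the values of F, so that
    all coefficients lie in I, that is, are divisible by p
    ([reduced_form_coef]).

    The residue field is never formed as a type: it is represented by a system
    of residues r_0, ..., r_(q-1) in O, and all equalities in it are
    memberships in I. *)

(** * Algebraic integers and ideals *)

Lemma alg_int0 (L : fieldExtType rat) : is_alg_int (0 : L).
Proof. exact: integral0. Qed.

Lemma alg_int1 (L : fieldExtType rat) : is_alg_int (1 : L).
Proof. exact: integral1. Qed.

Lemma alg_int_int (L : fieldExtType rat) (c : int) : is_alg_int (c%:~R : L).
Proof. exact: integral_id. Qed.

Lemma alg_int_nat (L : fieldExtType rat) (c : nat) : is_alg_int (c%:R : L).
Proof. exact: integral_nat. Qed.

Lemma alg_intN (L : fieldExtType rat) (x : L) :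
  is_alg_int x -> is_alg_int (- x).
Proof. exact: integral_opp. Qed.

Lemma alg_intD (L : fieldExtType rat) (x y : L) :
  is_alg_int x -> is_alg_int y -> is_alg_int (x + y).
Proof. exact: integral_add. Qed.

Lemma alg_intB (L : fieldExtType rat) (x y : L) :
  is_alg_int x -> is_alg_int y -> is_alg_int (x - y).
Proof. exact: integral_sub. Qed.

Lemma alg_intM (L : fieldExtType rat) (x y : L) :
  is_alg_int x -> is_alg_int y -> is_alg_int (x * y).
Proof. exact: integral_mul. Qed.

Lemma alg_int_sum (L : fieldExtType rat) (T : finType) (A : pred T)
    (F : T -> L) :
  (forall i, is_alg_int (F i)) -> is_alg_int (\sum_(i | A i) F i).
Proof.
move=> hF; apply: (big_ind (@is_alg_int L)) => //; first exact: alg_int0.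
exact: alg_intD.
Qed.

Lemma alg_int_prod (L : fieldExtType rat) (T : finType) (A : pred T)
    (F : T -> L) :
  (forall i, is_alg_int (F i)) -> is_alg_int (\prod_(i | A i) F i).
Proof.
move=> hF; apply: (big_ind (@is_alg_int L)) => //; first exact: alg_int1.
exact: alg_intM.
Qed.

Lemma alg_intX (L : fieldExtType rat) (x : L) (m : nat) :
  is_alg_int x -> is_alg_int (x ^+ m).
Proof.
move=> hx; elim: m => [|m IH]; first by rewrite expr0; apply: alg_int1.
by rewrite exprS; apply: alg_intM.
Qed.

Lemma alg_int_det (L : fieldExtType rat) (n : nat) (A : 'M[L]_n) :
  (forall i j, is_alg_int (A i j)) -> is_alg_int (\det A).
Proof.
move=> hA; apply: alg_int_sum => s; apply: alg_intM.
  by apply: alg_intX; apply: alg_intN; apply: alg_int1.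
exact: alg_int_prod.
Qed.

Lemma alg_int_adjugate (L : fieldExtType rat) (n : nat) (A : 'M[L]_n) :
  (forall i j, is_alg_int (A i j)) -> forall i j, is_alg_int ((\adj A) i j).
Proof.
move=> hA i j; rewrite !mxE; apply: alg_intM.
  by apply: alg_intX; apply: alg_intN; apply: alg_int1.
by apply: alg_int_det => i' j'; rewrite !mxE.
Qed.

Lemma alg_int_mmap (L : fieldExtType rat) (n : nat) (a : 'I_n -> L)
    (F : {mpoly int[n]}) :
  (forall i, is_alg_int (a i)) -> is_alg_int (mmap (intr : int -> L) a F).
Proof.
move=> ha; apply: (big_ind (@is_alg_int L)); first exact: alg_int0.
  exact: alg_intD.
move=> m _; apply: alg_intM; first exact: alg_int_int.
by apply: alg_int_prod => i; apply: alg_intX.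
Qed.

Lemma idealN (L : fieldExtType rat) (I : L -> Prop) (x : L) :
  is_ideal I -> I x -> I (- x).
Proof.
case=> _ _ _ hM hx; rewrite -mulN1r; apply: hM => //.
by apply: alg_intN; apply: alg_int1.
Qed.

Lemma idealB (L : fieldExtType rat) (I : L -> Prop) (x y : L) :
  is_ideal I -> I x -> I y -> I (x - y).
Proof.
move=> hI hx hy; case: (hI) => _ _ hD _.
by apply: hD => //; apply: idealN.
Qed.

Lemma idealMl (L : fieldExtType rat) (I : L -> Prop) (x y : L) :
  is_ideal I -> is_alg_int x -> I y -> I (x * y).
Proof. by move=> hI hx hy; case: hI => _ _ _ hM; apply: hM. Qed.

Lemma idealMr (L : fieldExtType rat) (I : L -> Prop) (x y : L) :
  is_ideal I -> I x -> is_alg_int y -> I (x * y).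
Proof. by move=> hI hx hy; rewrite mulrC; apply: idealMl. Qed.

Lemma ideal_sum (L : fieldExtType rat) (I : L -> Prop) (T : finType)
    (A : pred T) (F : T -> L) :
  is_ideal I -> (forall i, A i -> I (F i)) -> I (\sum_(i | A i) F i).
Proof. by case=> _ h0 hD _ hF; apply: (big_ind I). Qed.

Lemma ideal_congrM (L : fieldExtType rat) (I : L -> Prop) (x x' y y' : L) :
  is_ideal I -> is_alg_int x -> is_alg_int y' ->
  I (x - x') -> I (y - y') -> I (x * y - x' * y').
Proof.
move=> hI hx hy' hxx hyy; case: (hI) => _ _ hD _.
have -> : x * y - x' * y' = x * (y - y') + (x - x') * y' by ring.
by apply: hD; [apply: idealMl | apply: idealMr].
Qed.

Lemma ideal_congr_prod (L : fieldExtType rat) (I : L -> Prop) (T : finType)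
    (A : pred T) (F G : T -> L) :
  is_ideal I -> (forall i, is_alg_int (F i)) -> (forall i, is_alg_int (G i)) ->
  (forall i, A i -> I (F i - G i)) ->
  I (\prod_(i | A i) F i - \prod_(i | A i) G i).
Proof.
move=> hI hF hG hFG.
suff [] : [/\ is_alg_int (\prod_(i | A i) F i),
  is_alg_int (\prod_(i | A i) G i)
  & I (\prod_(i | A i) F i - \prod_(i | A i) G i)] by [].
apply: (big_ind2 (fun x y => [/\ is_alg_int x, is_alg_int y & I (x - y)])).
- by split; rewrite ?subrr; [apply: alg_int1..|case: hI].
- move=> x y x' y' [hx hy hxy] [hx' hy' hxy'].
  by split; [apply: alg_intM..|apply: ideal_congrM].
- by move=> i hi; split=> //; apply: hFG.
Qed.

Lemma ideal_congrX (L : fieldExtType rat) (I : L -> Prop) (x y : L) (m : nat) :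
  is_ideal I -> is_alg_int x -> is_alg_int y -> I (x - y) ->
  I (x ^+ m - y ^+ m).
Proof.
move=> hI hx hy hxy; rewrite -[m]card_ord -!prodr_const.
exact: ideal_congr_prod.
Qed.

Lemma ideal_congr_mmap (L : fieldExtType rat) (I : L -> Prop) (n : nat)
    (a b : 'I_n -> L) (F : {mpoly int[n]}) :
  is_ideal I -> (forall i, is_alg_int (a i)) -> (forall i, is_alg_int (b i)) ->
  (forall i, I (a i - b i)) ->
  I (mmap (intr : int -> L) a F - mmap (intr : int -> L) b F).
Proof.
move=> hI ha hb hab; rewrite /mmap -sumrB; case: (hI) => _ h0 hD _.
apply: (big_ind I) => // m _; rewrite -mulrBr; apply: idealMl => //.
  exact: alg_int_int.
apply: ideal_congr_prod => // i; try exact: alg_intX.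
by move=> _; apply: ideal_congrX.
Qed.

Lemma prime_ideal_prod (L : fieldExtType rat) (I : L -> Prop) (T : finType)
    (A : pred T) (F : T -> L) :
  is_prime_ideal I -> (forall i, is_alg_int (F i)) ->
  I (\prod_(i | A i) F i) -> exists2 i, A i & I (F i).
Proof.
case=> hI h1 hP hF hprod; apply: NNPP => hno.
suff [] : is_alg_int (\prod_(i | A i) F i) /\ ~ I (\prod_(i | A i) F i) by [].
apply: (big_ind (fun x => is_alg_int x /\ ~ I x)).
- by split=> //; apply: alg_int1.
- move=> x y [hx hnx] [hy hny]; split; first exact: alg_intM.
  by case/(hP _ _ hx hy).
- by move=> i hi; split=> // hFi; apply: hno; exists i.
Qed.

Lemma prime_idealX (L : fieldExtType rat) (I : L -> Prop) (x : L) (m : nat) :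
  is_prime_ideal I -> is_alg_int x -> I (x ^+ m) -> I x.
Proof.
move=> hI hx; rewrite -[m]card_ord -prodr_const => h.
by have [] := prime_ideal_prod hI _ h.
Qed.

Lemma prime_ideal_int (L : fieldExtType rat) (I : L -> Prop) (p : nat)
    (c : int) :
  is_prime_ideal I -> prime p -> I p%:R -> I c%:~R -> (p%:Z %| c)%Z.
Proof.
case=> hI h1 _ p_pr hp hc; apply: contraT; rewrite dvdzE => hndvd.
have hcop : coprimez p%:Z c by rewrite coprimezE prime_coprime.
have [[u v] /= huv] := coprimezP _ _ hcop.
case: h1; rewrite -[1]/(1%:~R) -huv rmorphD !rmorphM /=.
case: (hI) => _ _ hD _; apply: hD; apply: idealMl => //; exact: alg_int_int.
Qed.

(** * Products and powers of ideals *)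

Lemma ideal_mul_ind (L : fieldExtType rat) (I J Q : L -> Prop) :
  Q 0 -> (forall x y, Q x -> Q y -> Q (x + y)) ->
  (forall x y, I x -> J y -> Q (x * y)) -> forall x, ideal_mul I J x -> Q x.
Proof.
by move=> h0 hD hM x [m [a [b [ha hb ->]]]]; apply: (big_ind Q) => // i _; auto.
Qed.

Lemma ideal_mul_mem (L : fieldExtType rat) (I J : L -> Prop) (x y : L) :
  I x -> J y -> ideal_mul I J (x * y).
Proof.
by move=> hx hy; exists 1%N, (fun=> x), (fun=> y); split=> //; rewrite big_ord1.
Qed.

Lemma ideal_mul0 (L : fieldExtType rat) (I J : L -> Prop) : ideal_mul I J 0.
Proof.
by exists 0%N, (fun=> 0), (fun=> 0); split; [case | case | rewrite big_ord0].
Qed.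

Lemma ideal_mulD (L : fieldExtType rat) (I J : L -> Prop) (x y : L) :
  ideal_mul I J x -> ideal_mul I J y -> ideal_mul I J (x + y).
Proof.
case=> [m [a [b [ha hb ->]]]] [m' [a' [b' [ha' hb' ->]]]].
exists (m + m')%N,
  (fun i => match split i with inl j => a j | inr j => a' j end),
  (fun i => match split i with inl j => b j | inr j => b' j end).
split=> [i|i|]; [by case: split => j..|].
rewrite big_split_ord; congr (_ + _); apply: eq_bigr => i _.
  by rewrite (unsplitK (inl i)).
by rewrite (unsplitK (inr i)).
Qed.

Lemma ideal_alg_int (L : fieldExtType rat) : is_ideal (@is_alg_int L).
Proof.
by split=> // [|x y|x y]; [apply: alg_int0 | apply: alg_intD | apply: alg_intM].
Qed.

Lemma ideal_ideal_mul (L : fieldExtType rat) (I J : L -> Prop) :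
  is_ideal I -> is_ideal J -> is_ideal (ideal_mul I J).
Proof.
move=> hI hJ; case: (hI) => hIi _ _ hIM; case: (hJ) => hJi _ _ _; split.
- apply: ideal_mul_ind; [exact: alg_int0 | exact: alg_intD |].
  by move=> x y /hIi hx /hJi hy; apply: alg_intM.
- exact: ideal_mul0.
- exact: ideal_mulD.
- move=> a x ha; move: x; apply: ideal_mul_ind.
  + by rewrite mulr0; apply: ideal_mul0.
  + by move=> x y hx hy; rewrite mulrDr; apply: ideal_mulD.
  + by move=> x y hx hy; rewrite mulrA; apply: ideal_mul_mem => //; apply: hIM.
Qed.

Lemma ideal_ideal_exp (L : fieldExtType rat) (I : L -> Prop) (m : nat) :
  is_ideal I -> is_ideal (ideal_exp I m).
Proof.
move=> hI; elim: m => [|m IH]; first exact: ideal_alg_int.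
exact: ideal_ideal_mul.
Qed.

Lemma ideal_exp_mem (L : fieldExtType rat) (I : L -> Prop) (x : L) (m : nat) :
  I x -> ideal_exp I m (x ^+ m).
Proof.
move=> hx; elim: m => [|m IH]; first by rewrite expr0; apply: alg_int1.
by rewrite exprS; apply: ideal_mul_mem.
Qed.

(** One inclusion of [I ^ (m + k) = I ^ m * I ^ k]; it lets a power of an ideal
    be consumed [m] factors at a time. *)
Lemma ideal_expD (L : fieldExtType rat) (I : L -> Prop) (m k : nat) (x : L) :
  ideal_exp I (m + k) x -> ideal_mul (ideal_exp I m) (ideal_exp I k) x.
Proof.
elim: m x => [|m IH] x.
  by move=> hx; rewrite -[x]mul1r; apply: ideal_mul_mem => //; apply: alg_int1.
apply: (@ideal_mul_ind L I (ideal_exp I (m + k))).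
- exact: ideal_mul0.
- exact: ideal_mulD.
- move=> y z hy /IH; move: z; apply: ideal_mul_ind.
  + by rewrite mulr0; apply: ideal_mul0.
  + by move=> u v hu hv; rewrite mulrDr; apply: ideal_mulD.
  + move=> u v hu hv; rewrite mulrA; apply: ideal_mul_mem => //.
    exact: ideal_mul_mem.
Qed.

Lemma ideal_mul_subl (L : fieldExtType rat) (I J : L -> Prop) (x : L) :
  is_ideal I -> is_ideal J -> ideal_mul I J x -> I x.
Proof.
move=> hI [hJi _ _ _]; case: (hI) => _ h0 hD _; move: x.
by apply: ideal_mul_ind => // x y hx /hJi; apply: idealMr.
Qed.

Lemma ideal_mul_subr (L : fieldExtType rat) (I J : L -> Prop) (x : L) :
  is_ideal I -> is_ideal J -> ideal_mul I J x -> J x.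
Proof.
move=> [hIi _ _ _] hJ; case: (hJ) => _ h0 hD _; move: x.
by apply: ideal_mul_ind => // x y /hIi hx; apply: idealMl.
Qed.

Lemma ideal_big_mem (L : fieldExtType rat) (l : nat) (J : 'I_l -> L -> Prop)
    (x : 'I_l -> L) :
  (forall i, J i (x i)) ->
  (\big[@ideal_mul L/@is_alg_int L]_(i < l) J i) (\prod_(i < l) x i).
Proof.
move=> hJ; apply: (big_ind2 (fun (y : L) (I : L -> Prop) => I y)) => //.
  exact: alg_int1.
by move=> *; apply: ideal_mul_mem.
Qed.

Lemma ideal_big_sub (L : fieldExtType rat) (l : nat) (J : 'I_l -> L -> Prop)
    (i : 'I_l) (x : L) :
  (forall j, is_ideal (J j)) ->
  (\big[@ideal_mul L/@is_alg_int L]_(j < l) J j) x -> J i x.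
Proof.
move=> hJ; have: i \in index_enum 'I_l by apply: mem_index_enum.
elim: (index_enum _) x => [|j s IH] x //.
have hs : is_ideal (\big[@ideal_mul L/@is_alg_int L]_(j <- s) J j).
  apply: big_ind => //; [exact: ideal_alg_int | exact: ideal_ideal_mul].
rewrite inE big_cons => /orP[/eqP -> | hi] hx.
  exact: ideal_mul_subl hx.
by apply: IH => //; apply: ideal_mul_subr hx.
Qed.

(** * Residue systems of a prime ideal *)

(** A complete and irredundant set of representatives of O/I; besides giving the
    order of the residue field, it witnesses that this quotient is finite. *)
Definition residue_system (L : fieldExtType rat) (I : L -> Prop) (q : nat)
    (r : 'I_q -> L) : Prop :=
  [/\ forall i, is_alg_int (r i),
      forall x, is_alg_int x -> exists i, I (x - r i)
    & forall i j, I (r i - r j) -> i = j].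

(** The representatives are the combinations of the given basis with
    coefficients between 0 and p - 1. *)
Lemma residue_system_of_degree (L : fieldExtType rat) (I : L -> Prop)
    (p k : nat) :
  is_prime_ideal I -> prime p -> I p%:R -> residual_degree p I k ->
  exists r : 'I_(p ^ k) -> L, residue_system I r.
Proof.
move=> hP p_pr hp [b [hb hspan hfree]]; case: (hP) => hI _ _.
have hsum (c : 'I_k -> int) : is_alg_int (\sum_(i < k) (c i)%:~R * b i).
  by apply: alg_int_sum => i; apply: alg_intM => //; apply: alg_int_int.
have hcard : (p ^ k)%N = #|{ffun 'I_k -> 'I_p}| by rewrite card_ffun !card_ord.
pose T (i : 'I_(p ^ k)) : {ffun 'I_k -> 'I_p} := enum_val (cast_ord hcard i).
exists (fun i => \sum_(j < k) (T i j : nat)%:Z%:~R * b j); split=> //.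
- move=> x /hspan [c hc].
  have hmod (j : 'I_k) : (`|(c j %% p)%Z| < p)%N.
    have p_neq0 : p%:Z != 0 by rewrite eqz_nat -lt0n prime_gt0.
    by rewrite -ltz_nat gez0_abs ?modz_ge0 // ltz_pmod // ltz_nat prime_gt0.
  pose t : {ffun 'I_k -> 'I_p} := [ffun j => Ordinal (hmod j)].
  exists (cast_ord (esym hcard) (enum_rank t)).
  rewrite /T cast_ordKV enum_rankK; case: (hI) => _ _ hD _.
  rewrite -[x](subrK (\sum_(i < k) (c i)%:~R * b i)) -addrA; apply: hD => //.
  rewrite -sumrB; apply: ideal_sum => // j _.
  rewrite ffunE /= -mulrBl -rmorphB /= gez0_abs; last first.
    by rewrite modz_ge0 // eqz_nat -lt0n prime_gt0.
  rewrite {1}(divz_eq (c j) p) addrK rmorphM /= -mulrA.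
  apply: idealMl => //; first exact: alg_int_int.
  by rewrite -pmulrn; apply: idealMr.
- move=> i i'; rewrite -sumrB => h.
  have {}h : I (\sum_(j < k) ((T i j : nat)%:Z - (T i' j : nat)%:Z)%:~R * b j).
    by congr I : h; apply: eq_bigr => j _; rewrite rmorphB mulrBl.
  suff /enum_val_inj/cast_ord_inj : T i = T i' by [].
  apply/ffunP => j; apply/val_inj/eqP.
  move/hfree: h => /(_ j); rewrite -eqz_mod_dvd !modz_nat eqz_nat.
  by rewrite !modn_small.
Qed.

Lemma residue_system_gt1 (L : fieldExtType rat) (I : L -> Prop) (q : nat)
    (r : 'I_q -> L) :
  is_prime_ideal I -> residue_system I r -> (1 < q)%N.
Proof.
move=> [hI h1 _] [hr hsurj hinj].
have [i hi] := hsurj _ (alg_int0 L); have [j hj] := hsurj _ (alg_int1 L).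
rewrite ltnNge; apply/negP => q_le1; apply: h1.
have eq_ij : i = j by apply: val_inj => /=; move: (ltn_ord i) (ltn_ord j); lia.
rewrite -eq_ij in hj.
have -> : 1 = (1 - r i) - (0 - r i) by rewrite sub0r opprK subrK.
exact: idealB.
Qed.

(** Fermat's little theorem. Multiplication by a unit permutes the nonzero
    residues, hence multiplies their product by 1 and by the (q-1)-st power of
    that unit. *)
Lemma residue_fermat (L : fieldExtType rat) (I : L -> Prop) (q : nat)
    (r : 'I_q -> L) (a : L) :
  is_prime_ideal I -> residue_system I r -> is_alg_int a -> ~ I a ->
  I (a ^+ q.-1 - 1).
Proof.
move=> hP hres ha hna; case: (hP) => hI _ hprime; case: (hres) => hr hsurj hinj.
have hB := idealB hI.
have [h hh] : exists h : 'I_q -> 'I_q, forall i, I (a * r i - r (h i)).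
  apply: (fin_all_exists (P := fun i j => I (a * r i - r j))) => i.
  by apply: hsurj; apply: alg_intM.
have [i0 hi0] := hsurj _ (alg_int0 L).
have {}hi0 : I (r i0) by rewrite -[r i0]opprK -[- r i0]sub0r; apply: idealN.
have h_inj : injective h.
  move=> i j hij; apply: hinj.
  have : I (a * (r i - r j)).
    have -> : a * (r i - r j) = (a * r i - r (h i)) - (a * r j - r (h j)).
      by rewrite hij; ring.
    exact: hB.
  by case/hprime => //; apply: alg_intB.
have h0 : h i0 = i0.
  apply: hinj; apply: (hB) => //; rewrite -[r (h i0)](subKr (a * r i0)).
  by apply: (hB) => //; apply: idealMl.
have hne i : (h i != i0) = (i != i0) by rewrite -{1}h0 (inj_eq h_inj).
have hprod :
    I (\prod_(i < q | i != i0) (a * r i) - \prod_(i < q | i != i0) r i).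
  rewrite [X in _ - X](reindex_inj h_inj) /= (eq_bigl _ _ hne).
  by apply: ideal_congr_prod => // i; apply: alg_intM.
have hcard : #|[pred i : 'I_q | i != i0]| = q.-1.
  rewrite -[q in q.-1]card_ord [#|'I_q|](cardD1 i0) inE /=.
  by apply: eq_card => i; rewrite !inE andbT.
move: hprod; rewrite big_split /= prodr_const hcard -[X in _ - X]mul1r -mulrBl.
case/hprime => //.
  by apply: alg_intB; [apply: alg_intX | apply: alg_int1].
  exact: alg_int_prod.
case/(prime_ideal_prod hP hr) => i /eqP hi hri.
by case: hi; apply: hinj; apply: hB.
Qed.

Lemma residue_expr_card (L : fieldExtType rat) (I : L -> Prop) (q : nat)
    (r : 'I_q -> L) (a : L) :
  is_prime_ideal I -> residue_system I r -> is_alg_int a -> I (a ^+ q - a).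
Proof.
move=> hP hres ha; case: (hP) => hI _ _.
have q_gt1 := residue_system_gt1 hP hres.
have -> : a ^+ q - a = a * (a ^+ q.-1 - 1).
  by rewrite mulrBr mulr1 -exprS prednK // ltnW.
have [hIa|hIa] := classic (I a); last first.
  by apply: idealMl => //; apply: residue_fermat hres _ _.
apply: idealMr => //.
by apply: alg_intB; [apply: alg_intX | apply: alg_int1].
Qed.

Lemma residue_inverse (L : fieldExtType rat) (I : L -> Prop) (q : nat)
    (r : 'I_q -> L) (a : L) :
  is_prime_ideal I -> residue_system I r -> is_alg_int a -> ~ I a ->
  exists2 b, is_alg_int b & I (b * a - 1).
Proof.
move=> hP hres ha hna; exists (a ^+ q.-2); first exact: alg_intX.
have q_gt1 := residue_system_gt1 hP hres.
rewrite -exprSr prednK -?subn1 ?subn_gt0 // subn1.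
exact: residue_fermat hres _ _.
Qed.

(** A prime with a finite residue ring is maximal, since nonmembers are units
    modulo it. *)
Lemma residue_system_maximal (L : fieldExtType rat) (I J : L -> Prop) (q : nat)
    (r : 'I_q -> L) :
  is_prime_ideal I -> is_prime_ideal J -> residue_system I r ->
  (forall x, I x -> J x) -> eq_ideal I J.
Proof.
move=> hP [hJ hJ1 _] hres hIJ x; split; first exact: hIJ.
move=> hx; apply: NNPP => hnx; case: (hJ) => hJi _ _ _.
have [b hb hbx] := residue_inverse hP hres (hJi _ hx) hnx.
case: hJ1; rewrite -[1](subKr (b * x)); apply: idealB => //.
  exact: idealMl.
exact: hIJ.
Qed.

(** * Polynomials vanishing at all residues *)

(** The residues are pairwise distinct modulo the prime, so their Vandermonde
    determinant d stays outside of it, and the rows of the adjugate matrix are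
    integral functionals that read off d times each coefficient of a polynomial
    of degree less than q from its values at the residues. *)
Lemma residue_interpolation (L : fieldExtType rat) (I : L -> Prop) (q : nat)
    (r : 'I_q -> L) :
  is_prime_ideal I -> residue_system I r ->
  exists (d : L) (w : 'I_q -> 'I_q -> L),
    [/\ is_alg_int d, ~ I d, forall i c, is_alg_int (w i c)
      & forall i j : 'I_q, \sum_(c < q) w i c * r c ^+ j = d *+ (i == j)].
Proof.
move=> hP [hr _ hinj].
pose V := (Vandermonde q (\row_j r j))^T.
have hV i j : is_alg_int (V i j) by rewrite !mxE; apply: alg_intX.
exists (\det V), (\adj V); split;
  [exact: alg_int_det | | exact: alg_int_adjugate |].
  rewrite det_tr det_Vandermonde.
  case/(prime_ideal_prod hP) => [i|i _].
    by apply: alg_int_prod => j; rewrite !mxE; apply: alg_intB.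
  case/(prime_ideal_prod hP) => [j|j ij].
    by rewrite !mxE; apply: alg_intB.
  by rewrite !mxE => /hinj ji; rewrite ji ltnn in ij.
move=> i j; have /matrixP/(_ i j) := mul_adj_mx V.
by rewrite !mxE => <-; apply: eq_bigr => c _; rewrite !mxE.
Qed.

(** Apply in each variable i the interpolation functional of degree [m i]: the
    sum of the products of weights times values is an element of the prime, and
    it equals [d ^ n * g m] with d outside of the prime. *)
Lemma reduced_form_coef (L : fieldExtType rat) (I : L -> Prop) (q n : nat)
    (r : 'I_q -> L) (g : {ffun 'I_n -> 'I_q} -> L) :
  is_prime_ideal I -> residue_system I r -> (forall m, is_alg_int (g m)) ->
  (forall s : {ffun 'I_n -> 'I_q},
     I (\sum_m g m * \prod_(i < n) r (s i) ^+ m i)) ->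
  forall m, I (g m).
Proof.
move=> hP hres hg hvan m; case: (hP) => hI _ hprime.
have [d [w [hd hId hw hdw]]] := residue_interpolation hP hres.
suff : I (d ^+ n * g m).
  case/hprime => //; first exact: alg_intX.
  by move/(prime_idealX hP hd).
have <- : \sum_(s : {ffun 'I_n -> 'I_q}) (\prod_(i < n) w (m i) (s i)) *
    (\sum_m' g m' * \prod_(i < n) r (s i) ^+ m' i) = d ^+ n * g m.
  under eq_bigr => s _ do rewrite big_distrr /=.
  rewrite exchange_big /= (bigD1 m) //= [X in _ + X]big1 => [|m' m'_neq].
    rewrite addr0 -[n in _ ^+ n]card_ord -prodr_const mulrC.
    have -> : \prod_(i < n) d =
        \prod_(i < n) \sum_(c < q) w (m i) c * r c ^+ m i.
      by apply: eq_bigr => i _; rewrite hdw eqxx.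
    rewrite bigA_distr_bigA big_distrr /=; apply: eq_bigr => s _.
    by rewrite big_split /= mulrCA.
  under eq_bigr => s _ do rewrite mulrCA -big_split /=.
  rewrite -big_distrr /=.
  rewrite -(bigA_distr_bigA (fun i c => w (m i) c * r c ^+ m' i)) /=.
  have [i hi] : exists i, m i != m' i.
    apply/existsP; apply: contraNT m'_neq => /existsPn h; apply/eqP/ffunP => i.
    by apply/esym/eqP; move: (h i); rewrite negbK.
  by rewrite (bigD1 i) //= hdw (negbTE hi) mulr0n mul0r mulr0.
apply: ideal_sum => // s _; apply: idealMl => //; exact: alg_int_prod.
Qed.

(** As long as the exponent e is at least q, it can be lowered by q - 1. *)
Lemma expr_reduce (R : comNzRingType) (x : R) (q e : nat) : (1 < q)%N ->
  exists (e' : 'I_q) (h : R), x ^+ e = x ^+ e' + h * (x ^+ q - x).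
Proof.
move=> q_gt1; elim/ltn_ind: e => e IH.
have [e_lt|e_ge] := ltnP e q.
  by exists (Ordinal e_lt), 0; rewrite mul0r addr0.
have [|e' [h he]] := IH (e - q).+1; first by lia.
exists e', (h + x ^+ (e - q)); rewrite mulrDl addrA -he mulrBr -exprD subnK //.
by rewrite -exprSr addrC subrK.
Qed.

(** Modulo the ideal J of the [X_i ^ q - X_i], a monomial is a product of powers
    that can be reduced one variable at a time. *)
Lemma reduced_form_exists (q n : nat) (F : {mpoly int[n]}) : (1 < q)%N ->
  exists (g : {ffun 'I_n -> 'I_q} -> int) (H : 'I_n -> {mpoly int[n]}),
    F = \sum_m g m *: \prod_(i < n) 'X_i ^+ m i
        + \sum_(i < n) H i * ('X_i ^+ q - 'X_i).
Proof.
move=> q_gt1.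
pose J (G : {mpoly int[n]}) := exists H : 'I_n -> {mpoly int[n]},
  G = \sum_(i < n) H i * ('X_i ^+ q - 'X_i).
have J0 : J 0 by exists (fun=> 0); rewrite big1 // => i _; rewrite mul0r.
have JD G G' : J G -> J G' -> J (G + G').
  case=> [H ->] [H' ->]; exists (fun i => H i + H' i).
  by rewrite -big_split; apply: eq_bigr => i _; rewrite mulrDl.
have JM G G' : J G' -> J (G * G').
  case=> [H ->]; exists (fun i => G * H i).
  by rewrite big_distrr /=; apply: eq_bigr => i _; rewrite mulrA.
suff [g hg] : exists g : {ffun 'I_n -> 'I_q} -> int,
    J (F - \sum_m g m *: \prod_(i < n) 'X_i ^+ m i).
  by case: hg => H hH; exists g, H; rewrite -hH addrC subrK.
elim/mpolyind: F => [|c m F _ _ [g hg]].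
  exists (fun=> 0); rewrite big1 ?subr0 // => m _; exact: scale0r.
have [m' hm'] : exists m' : {ffun 'I_n -> 'I_q},
    forall i, J ('X_i ^+ m i - 'X_i ^+ m' i).
  have [m' hm'] : exists m' : 'I_n -> 'I_q, forall i, exists h : {mpoly int[n]},
      'X_i ^+ m i = 'X_i ^+ m' i + h * ('X_i ^+ q - 'X_i).
    apply: (fin_all_exists (P := fun (i : 'I_n) (j : 'I_q) =>
      exists h : {mpoly int[n]},
        'X_i ^+ m i = 'X_i ^+ j + h * ('X_i ^+ q - 'X_i))) => i.
    exact: expr_reduce.
  exists [ffun i => m' i] => i; rewrite ffunE; have [h ->] := hm' i.
  rewrite addrC addKr; apply: JM; exists (fun j => (j == i)%:R).
  rewrite (bigD1 i) //= eqxx mul1r big1 ?addr0 // => j /negbTE ->.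
  by rewrite mul0r.
exists (fun s => g s + c *+ (s == m')).
have -> : \sum_s (g s + c *+ (s == m')) *: \prod_(i < n) 'X_i ^+ s i =
    \sum_s g s *: \prod_(i < n) 'X_i ^+ s i
    + c *: \prod_(i < n) 'X_i ^+ m' i :> {mpoly int[n]}.
  under eq_bigr => s _ do rewrite scalerDl.
  rewrite big_split /=; congr (_ + _); rewrite (bigD1 m') //= eqxx.
  rewrite [X in _ + X]big1 ?addr0 //.
  by move=> s /negbTE ->; rewrite mulr0n scale0r.
set S := \sum_s _; rewrite mpolyXE_id.
have -> : c *: \prod_(i < n) 'X_i ^+ m i + F
    - (S + c *: \prod_(i < n) 'X_i ^+ m' i)
  = (F - S) + c%:MP * (\prod_(i < n) 'X_i ^+ m i - \prod_(i < n) 'X_i ^+ m' i).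
  by rewrite !mul_mpolyC; ring.
apply: (JD) => //; apply: (JM).
apply: (big_ind2 (fun x y => J (x - y))); rewrite ?subrr //.
move=> x x' y y' hx hy.
have -> : x * y - x' * y' = x * (y - y') + y' * (x - x') by ring.
by apply: JD; apply: JM.
Qed.

Lemma contains_divisor_system_vanish (L : fieldExtType rat) (I : L -> Prop)
    (p k n : nat) (r : 'I_(p ^ k) -> L) (F : {mpoly int[n]}) (a : 'I_n -> L) :
  is_prime_ideal I -> I p%:R -> residue_system I r ->
  contains_divisor_system p k F -> (forall i, is_alg_int (a i)) ->
  I (mmap (intr : int -> L) a F).
Proof.
move=> hP hp hres [G [H ->]] ha; case: (hP) => hI _ _; case: (hI) => _ _ hD _.
rewrite rmorphD rmorphM rmorph_nat rmorph_sum /=; apply: hD.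
  by apply: idealMr => //; apply: alg_int_mmap.
apply: ideal_sum => // i _; rewrite rmorphM rmorphB rmorphXn /= mmapX mmap1U.
apply: idealMl => //; first exact: alg_int_mmap.
exact: residue_expr_card hres (ha i).
Qed.

Lemma vanish_contains_divisor_system (L : fieldExtType rat) (I : L -> Prop)
    (p k n : nat) (r : 'I_(p ^ k) -> L) (F : {mpoly int[n]}) :
  is_prime_ideal I -> prime p -> I p%:R -> residue_system I r ->
  (forall a : 'I_n -> L, (forall i, is_alg_int (a i)) ->
     I (mmap (intr : int -> L) a F)) ->
  contains_divisor_system p k F.
Proof.
move=> hP p_pr hp hres hvan; case: (hP) => hI _ _; case: (hres) => hr _ _.
have [g [H hF]] := reduced_form_exists F (residue_system_gt1 hP hres).
have hg m : (p%:Z %| g m)%Z.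
  apply: (prime_ideal_int hP p_pr hp); move: m.
  apply: (reduced_form_coef hP hres) => [m|s]; first exact: alg_int_int.
  pose a i := r (s i).
  have ha i : is_alg_int (a i) by apply: hr.
  have -> : \sum_m (g m)%:~R * \prod_(i < n) r (s i) ^+ m i =
      mmap (intr : int -> L) a F
      - mmap (intr : int -> L) a (\sum_(i < n) H i * ('X_i ^+ (p ^ k) - 'X_i)).
    rewrite -rmorphB /= {1}hF addrK rmorph_sum /=; apply: eq_bigr => m _.
    rewrite mmapZ rmorph_prod /=; congr (_ * _); apply: eq_bigr => i _.
    by rewrite rmorphXn /= mmapX mmap1U.
  apply: idealB => //; first exact: hvan.
  apply: (contains_divisor_system_vanish hP hp hres) => //.
  by exists 0, H; rewrite mulr0 add0r.
exists (\sum_m (g m %/ p)%Z *: \prod_(i < n) 'X_i ^+ m i), H.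
rewrite {1}hF big_distrr /=; congr (_ + _); apply: eq_bigr => m _.
rewrite -{1}(divzK (hg m)) mulrC -scalerA -[p%:Z]natz scaler_nat.
by rewrite mulr_natl.
Qed.

(** * The primes above p *)

Lemma decomposition_over (L : fieldExtType rat) (p l : nat)
    (P : 'I_l -> L -> Prop) (e : 'I_l -> nat) (i : 'I_l) :
  prime_ideal_decomposition p P e -> P i p%:R.
Proof.
case=> hP _ he hdec; have hI j : is_ideal (P j) by case: (hP j).
have /hdec hp : principal_ideal p%:R (p%:R : L).
  by exists 1; [apply: alg_int1 | rewrite mulr1].
have := ideal_big_sub i (fun j => ideal_ideal_exp (e j) (hI j)) hp.
rewrite -[e i]prednK // => hpi; apply: ideal_mul_subl hpi => //.
exact: ideal_ideal_exp.
Qed.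

(** Otherwise a product of powers of elements of the [P i] outside of I would be
    an element of pO, hence of the prime I. *)
Lemma decomposition_complete (L : fieldExtType rat) (p l : nat)
    (P : 'I_l -> L -> Prop) (e : 'I_l -> nat) (I : L -> Prop) :
  prime_ideal_decomposition p P e -> is_prime_ideal I -> I p%:R ->
  exists i, forall x, P i x -> I x.
Proof.
case=> hP _ _ hdec hI hp; apply: NNPP => hno.
have hPi i x : P i x -> is_alg_int x.
  by case: (hP i) => [[h _ _ _] _ _]; apply: h.
have [z hz] : exists z : 'I_l -> L, forall i, P i (z i) /\ ~ I (z i).
  apply: (fin_all_exists (P := fun i x => P i x /\ ~ I x)) => i.
  apply: NNPP => hno'; apply: hno; exists i => x hx.
  by apply: NNPP => hIx; apply: hno'; exists x.
have : (\big[@ideal_mul L/@is_alg_int L]_(i < l) ideal_exp (P i) (e i))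
    (\prod_(i < l) z i ^+ e i).
  by apply: ideal_big_mem => i; apply: ideal_exp_mem; case: (hz i).
case/hdec=> y hy hzy.
have : I (\prod_(i < l) z i ^+ e i).
  by rewrite hzy; apply: idealMr => //; case: hI.
case/(prime_ideal_prod hI) => [i|i _].
  by apply: alg_intX; apply: (hPi i); case: (hz i).
by have [hPz hIz] := hz i; move/(prime_idealX hI (hPi i _ hPz)).
Qed.

(** By maximality no [P j] is contained in [P i]; multiply together one element
    of each difference. *)
Lemma prime_ideal_separator (L : fieldExtType rat) (l : nat)
    (P : 'I_l -> L -> Prop) (q : 'I_l -> nat) (r : forall i, 'I_(q i) -> L)
    (i : 'I_l) :
  (forall j, is_prime_ideal (P j)) ->
  (forall j j', eq_ideal (P j) (P j') -> j = j') ->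
  (forall j, residue_system (P j) (r j)) ->
  exists z, [/\ is_alg_int z, ~ P i z & forall j, j != i -> P j z].
Proof.
move=> hP hdist hres.
have hPj j x : P j x -> is_alg_int x.
  by case: (hP j) => [[h _ _ _] _ _]; apply: h.
have [z hz] : exists z : 'I_l -> L, forall j,
    is_alg_int (z j) /\ (j != i -> P j (z j) /\ ~ P i (z j)).
  apply: (fin_all_exists (P := fun j x =>
    is_alg_int x /\ (j != i -> P j x /\ ~ P i x))) => j.
  have [->|ji] := eqVneq j i; first by exists 0; split=> //; apply: alg_int0.
  apply: NNPP => hno; case/eqP: ji; apply: hdist.
  apply: residue_system_maximal (hres j) _ => // x hx.
  by apply: NNPP => hnx; apply: hno; exists x; split=> //; apply: hPj hx.
have hz_int j : is_alg_int (z j) by case: (hz j).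
exists (\prod_(j < l | j != i) z j); split; first exact: alg_int_prod.
  by case/(prime_ideal_prod (hP i)) => // j ji; case: (hz j) => _ /(_ ji) [].
move=> j ji; rewrite (bigD1 j) //=; apply: idealMr; first by case: (hP j).
  by case: (hz j) => _ /(_ ji) [].
exact: alg_int_prod.
Qed.

Lemma chinese_remainder (L : fieldExtType rat) (l : nat)
    (P : 'I_l -> L -> Prop) (q : 'I_l -> nat) (r : forall i, 'I_(q i) -> L)
    (a : 'I_l -> L) :
  (forall j, is_prime_ideal (P j)) ->
  (forall j j', eq_ideal (P j) (P j') -> j = j') ->
  (forall j, residue_system (P j) (r j)) ->
  (forall i, is_alg_int (a i)) ->
  exists2 b, is_alg_int b & forall i, P i (b - a i).
Proof.
move=> hP hdist hres ha.
have [u hu] : exists u : 'I_l -> L, forall i,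
    [/\ is_alg_int (u i), P i (u i - 1) & forall j, j != i -> P j (u i)].
  apply: (fin_all_exists (P := fun i x =>
    [/\ is_alg_int x, P i (x - 1) & forall j, j != i -> P j x])) => i.
  have [z [hz hzi hzj]] := prime_ideal_separator i hP hdist hres.
  have [b hb hbz] := residue_inverse (hP i) (hres i) hz hzi.
  exists (b * z); split=> // [|j ji]; first exact: alg_intM.
  by apply: idealMl => //; [case: (hP j) | apply: hzj].
have hu_int i : is_alg_int (u i) by case: (hu i).
exists (\sum_(i < l) u i * a i).
  by apply: alg_int_sum => i; apply: alg_intM.
move=> i; case: (hP i) => hI _ _; case: (hI) => _ _ hD _.
rewrite (bigD1 i) //= addrAC -[X in _ - X]mul1r -mulrBl; apply: hD.
  by apply: idealMr => //; case: (hu i).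
apply: ideal_sum => // j ji; apply: idealMr => //.
by case: (hu j) => _ _; apply; rewrite eq_sym.
Qed.

(** If z lies in every prime above p but [P i], then multiplying by a power of
    z turns membership in [P i ^ (e i * t)] into divisibility by [p ^ t]; as z
    is a unit modulo [P i], this forces [p ^ t] to divide the integer D. *)
Lemma int_not_in_all_powers (L : fieldExtType rat) (p l : nat)
    (P : 'I_l -> L -> Prop) (e q : 'I_l -> nat) (r : forall i, 'I_(q i) -> L)
    (i : 'I_l) (D : int) :
  prime p -> prime_ideal_decomposition p P e ->
  (forall j, residue_system (P j) (r j)) ->
  (forall m, ideal_exp (P i) m (D%:~R : L)) -> D = 0.
Proof.
move=> p_pr hdecomp hres hD; have hp := decomposition_over i hdecomp.
case: (hdecomp) => hP hdist _ hdec.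
have [z [hz hzi hzj]] := prime_ideal_separator i hP hdist hres.
pose w : L := \prod_(j < l | j != i) z ^+ e j.
have hw : is_alg_int w by apply: alg_int_prod => j; apply: alg_intX.
have hwi : ~ P i w.
  case/(prime_ideal_prod (hP i)) => [j|j _]; first exact: alg_intX.
  by move/(prime_idealX (hP i) hz).
have step x : ideal_exp (P i) (e i) x -> principal_ideal p%:R (x * w).
  (* One factor from each of the powers whose product is pO. *)
  move=> hx; apply/hdec.
  have -> : x * w = \prod_(j < l) (if j == i then x else z ^+ e j).
    rewrite (bigD1 i) //= eqxx; congr (_ * _).
    by apply: eq_bigr => j /negbTE ->.
  apply: ideal_big_mem => j; case: (eqVneq j i) => [->|ji] //.
  by apply: ideal_exp_mem; apply: hzj.
have iter_step t x : ideal_exp (P i) (e i * t) x ->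
    principal_ideal (p%:R ^+ t) (x * w ^+ t).
  elim: t x => [|t IH] x.
    by rewrite muln0 => hx; exists x; rewrite // !expr0 mulr1 mul1r.
  rewrite mulnS => /ideal_expD; move: x; apply: ideal_mul_ind.
  - by exists 0; rewrite ?mul0r ?mulr0 //; apply: alg_int0.
  - move=> x y [x' hx' hx] [y' hy' hy]; exists (x' + y'); first exact: alg_intD.
    by rewrite mulrDl hx hy mulrDr.
  - move=> x y /step [x' hx' hx] /IH [y' hy' hy].
    exists (x' * y'); first exact: alg_intM.
    by rewrite exprS mulrACA hx hy exprS mulrACA.
have hdvd N t : principal_ideal (p%:R ^+ t) (D%:~R * w ^+ N) ->
    (p%:Z ^+ t %| D)%Z.
  elim: t => [|t IH] [y hy hyD]; first by rewrite expr0 dvd1z.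
  have /dvdzP [D' hD'] : (p%:Z ^+ t %| D)%Z.
    apply: IH; exists (p%:R * y); last by rewrite hyD exprSr mulrA.
    by apply: alg_intM => //; apply: alg_int_nat.
  rewrite exprS hD' dvdz_mul //.
  have p_neq0 : (p%:R : L) != 0.
    rewrite -(rmorph_nat (in_alg L)) fmorph_eq0 pnatr_eq0 -lt0n.
    exact: prime_gt0.
  have hD'w : D'%:~R * w ^+ N = p%:R * y.
    apply: (mulfI (expf_neq0 t p_neq0)); rewrite [RHS]mulrA -exprSr -hyD hD'.
    by rewrite rmorphM rmorphXn /= -pmulrn mulrA [X in X * _]mulrC.
  apply: (prime_ideal_int (hP i)) => //; case: (hP i) => hI _ hprime.
  have : P i (D'%:~R * w ^+ N) by rewrite hD'w; apply: idealMr.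
  case/hprime => //; [exact: alg_int_int | exact: alg_intX |].
  by move/(prime_idealX (hP i) hw).
apply/eqP; apply: contraT => D_neq0.
have := hdvd _ _ (iter_step `|D|%N _ (hD _)).
rewrite dvdzE abszX absz_nat => /dvdn_leq; rewrite absz_gt0 => /(_ D_neq0).
by rewrite leqNgt ltn_expl // prime_gt1.
Qed.

(** * The discriminant is not zero *)

(** Clearing denominators, an integral basis is linearly independent over the
    rationals; having as many elements as the degree, it spans the field. *)
Lemma integral_basis_span (K : fieldExtType rat) (n : nat) (xi : 'I_n -> K) :
  \dim {: K} = n -> is_integral_basis xi ->
  forall x, exists c : 'I_n -> rat, x = \sum_(i < n) c i *: xi i.
Proof.
move=> degK [_ _ hfree] x; pose X := [tuple xi i | i < n].
have hX (i : 'I_n) : X`_i = xi i by rewrite -tnth_nth tnth_mktuple.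
have X_free : free X.
  apply/freeP => c hc i; pose N := \prod_(j < n) denq (c j).
  have N_neq0 : N%:~R != 0 :> rat.
    by rewrite intr_eq0; apply/prodf_neq0 => j _; rewrite denq_neq0.
  have hint j : exists d : int, N%:~R * c j = d%:~R.
    exists (numq (c j) * \prod_(j' < n | j' != j) denq (c j')).
    rewrite /N (bigD1 j) //= -{2}[c j]divq_num_den !rmorphM /=.
    rewrite [X in X * (_ / _)]mulrC -mulrA [X in _ * X]mulrCA divff ?mulr1.
      by rewrite mulrC.
    by rewrite intr_eq0 denq_neq0.
  have [d hd] : exists d : 'I_n -> int, forall j, N%:~R * c j = (d j)%:~R.
    exact: (fin_all_exists (P := fun j d => N%:~R * c j = d%:~R)).
  have d0 : d i = 0.
    apply: hfree; rewrite -[RHS](scaler0 _ (N%:~R : rat)) -[X in _ = _ *: X]hc.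
    rewrite scaler_sumr.
    apply: eq_bigr => j _; rewrite scalerA hd hX -[in RHS](mulr1 (xi j)).
    by rewrite -scaler_int -scalerAl mul1r mulr1.
  by move: (hd i); rewrite d0 => /eqP; rewrite mulf_eq0 (negbTE N_neq0) => /eqP.
have hspan : x \in <<X>>%VS.
  have /eqP -> : (<<X>> == fullv)%VS; last exact: memvf.
  rewrite -(geq_leqif (dimv_leqif_eq (subvf _))) degK (eqP X_free).
  by rewrite size_tuple.
exists (fun i => coord X i x); rewrite {1}(coord_span hspan).
by apply: eq_bigr => i _; rewrite hX.
Qed.

Lemma embedding_scale (K : fieldExtType rat) (s : {rmorphism K -> algC})
    (c : rat) (x : K) : s (c *: x) = ratr c * s x.
Proof.
rewrite -mulr_algl rmorphM; congr (_ * _).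
exact: (fmorph_eq_rat (s \o in_alg K)).
Qed.

(** If D were zero, two of the conjugate forms would coincide, and so would the
    two embeddings that they come from. *)
Lemma discriminant_neq0 (K : fieldExtType rat) (n : nat)
    (sigma : 'I_n -> {rmorphism K -> algC}) (xi : 'I_n -> K) (D : int)
    (Delta : {mpoly int[n]}) :
  \dim {: K} = n -> enumerates_embeddings sigma -> is_integral_basis xi ->
  is_primitive_discriminant_form sigma xi D Delta -> D <> 0.
Proof.
move=> degK [sigma_inj _] hxi [_ _ hdisc] D0; move: hdisc.
rewrite D0 mpolyC0 mulr0 rmorph0 => /eqP/prodf_eq0 [i _ /prodf_eq0 [j ij]].
rewrite expf_eq0 /= subr_eq0 => /eqP eq_form.
suff eq_ij : i = j by rewrite eq_ij ltnn in ij.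
apply: sigma_inj => x; have [c ->] := integral_basis_span degK hxi x.
rewrite !rmorph_sum /=; apply: eq_bigr => k _; rewrite !embedding_scale.
congr (_ * _); have /(congr1 (mcoeff U_(k))) := eq_form.
have coef i' : (conj_fundamental_form sigma xi i')@_U_(k) = sigma i' (xi k).
  rewrite raddf_sum (bigD1 k) //= mcoeffZ mcoeffX eqxx mulr1 big1 ?addr0 //.
  by move=> k' /negbTE hk'; rewrite mcoeffZ mcoeffXU hk' mulr0.
by rewrite !coef.
Qed.

(** * Supplementary domains *)

(** If Delta(a) avoids I, pick b with t = 1 - b Delta(a)^2 in I; then t^m is in
    I^m and 1 - t^m is a multiple of Delta(a)^2, so D = D t^m + D (1 - t^m) is
    in I^m as soon as Delta(a)^2 D is. *)
Lemma supplementary_coprime (L : fieldExtType rat) (p l n : nat)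
    (P : 'I_l -> L -> Prop) (e q : 'I_l -> nat) (r : forall i, 'I_(q i) -> L)
    (Delta : {mpoly int[n]}) (D : int) :
  prime p -> prime_ideal_decomposition p P e ->
  (forall j, residue_system (P j) (r j)) -> D <> 0 ->
  supplementary_domain L p Delta D <->
  (exists2 a : 'I_n -> L, forall i, is_alg_int (a i)
     & forall i, ~ P i (mmap (intr : int -> L) a Delta)).
Proof.
move=> p_pr hdecomp hres D_neq0; case: (hdecomp) => hP _ _ _.
split=> [[a [ha hsup]]|[a ha hcop]].
  exists a => // i hDelta; apply: D_neq0.
  apply: (int_not_in_all_powers (i := i) p_pr hdecomp hres).
  elim=> [|m IH]; first exact: alg_int_int.
  apply: hsup => //; first exact: decomposition_over hdecomp.
  rewrite expr2 -mulrA; apply: ideal_mul_mem => //.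
  case: (hP i) => hI _ _; apply: idealMl => //; first exact: ideal_ideal_exp.
  exact: alg_int_mmap.
exists a; split=> // I hI hp m; set x := mmap _ _ _.
have [i hi] := decomposition_complete hdecomp hI hp.
have hx : is_alg_int x by apply: alg_int_mmap.
have [||b hb hbx] := residue_inverse (hP i) (hres i) (a := x ^+ 2).
- exact: alg_intX.
- by move/(prime_idealX (hP i) hx); apply: hcop.
case: (hI) => hIi _ _; have hIm := ideal_ideal_exp m hIi.
move=> hxD; case: (hIm) => _ _ hadd _.
set t := 1 - b * x ^+ 2.
have ht : I t by rewrite -[t]opprB; apply: idealN => //; apply: hi.
have t_int : is_alg_int t by case: hIi => h _ _ _; apply: h.
pose g := \sum_(k < m) t ^+ k.
have geom : b * x ^+ 2 * g = 1 - t ^+ m.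
  rewrite -[RHS]opprB subrX1 -mulNr; congr (_ * _); rewrite /t; ring.
have -> : (D%:~R : L) = D%:~R * t ^+ m + (b * g) * (x ^+ 2 * D%:~R).
  have -> : (b * g) * (x ^+ 2 * D%:~R) = D%:~R * (b * x ^+ 2 * g) by ring.
  by rewrite geom; ring.
apply: hadd; apply: idealMl => //; first exact: alg_int_int.
  exact: ideal_exp_mem.
by apply: alg_intM => //; apply: alg_int_sum => k; apply: alg_intX.
Qed.

(** By the Chinese remainder theorem the conditions at the primes above p are
    independent of each other. *)
Lemma coprime_value_local (L : fieldExtType rat) (l n : nat)
    (P : 'I_l -> L -> Prop) (q : 'I_l -> nat) (r : forall i, 'I_(q i) -> L)
    (F : {mpoly int[n]}) :
  (forall j, is_prime_ideal (P j)) ->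
  (forall j j', eq_ideal (P j) (P j') -> j = j') ->
  (forall j, residue_system (P j) (r j)) ->
  (forall i, exists2 a : 'I_n -> L, forall k, is_alg_int (a k)
     & ~ P i (mmap (intr : int -> L) a F)) ->
  exists2 a : 'I_n -> L, forall k, is_alg_int (a k)
     & forall i, ~ P i (mmap (intr : int -> L) a F).
Proof.
move=> hP hdist hres hloc.
have [a ha] : exists a : 'I_l -> 'I_n -> L, forall i,
    (forall k, is_alg_int (a i k)) /\ ~ P i (mmap (intr : int -> L) (a i) F).
  apply: (fin_all_exists (P := fun i a => (forall k, is_alg_int (a k)) /\
    ~ P i (mmap (intr : int -> L) a F))) => i.
  by have [a ha hF] := hloc i; exists a.
have [b hb] : exists b : 'I_n -> L, forall k,
    is_alg_int (b k) /\ forall i, P i (b k - a i k).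
  apply: (fin_all_exists (P := fun k b =>
    is_alg_int b /\ forall i, P i (b - a i k))) => k.
  have [|b hb hba] := chinese_remainder (a := a^~ k) hP hdist hres.
    by move=> i; case: (ha i).
  by exists b.
have hb_int k : is_alg_int (b k) by case: (hb k).
exists b => // i hi; have [hai haF] := ha i; apply: haF.
case: (hP i) => hI _ _.
rewrite -[mmap _ _ _](subKr (mmap (intr : int -> L) b F)); apply: idealB => //.
by apply: ideal_congr_mmap => // k; case: (hb k).
Qed.

Theorem mainTheorem16 (K : fieldExtType rat) (n : nat)
  (degK : \dim {: K} = n)
  (sigma : 'I_n -> {rmorphism K -> algC})
  (sigmaP : enumerates_embeddings sigma)
  (xi : 'I_n -> K) (xiP : is_integral_basis xi)
  (D : int) (DP : is_field_discriminant sigma xi D)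
  (Delta : {mpoly int[n]})
  (DeltaP : is_primitive_discriminant_form sigma xi D Delta)
  (Gamma : fieldExtType rat)
  (p : nat) (p_prime : prime p)
  (l : nat) (P : 'I_l -> Gamma -> Prop) (e : 'I_l -> nat)
  (decomp : prime_ideal_decomposition p P e)
  (f : 'I_l -> nat) (fP : forall i, residual_degree p (P i) (f i))
  (lambda : nat) (k : 'I_lambda -> nat)
  (k_inj : injective k)
  (kP : forall d : nat, (exists j, k j = d) <-> (exists i, f i = d)) :
  supplementary_domain Gamma p Delta D <->
  (forall j : 'I_lambda, ~ contains_divisor_system p (k j) Delta).
Proof.
have [hP hdist _ _] := decomp.
have hp i : P i p%:R by apply: decomposition_over decomp.
have [r hres] : exists r : forall i, 'I_(p ^ f i) -> Gamma,
    forall i, residue_system (P i) (r i).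
  apply: (fin_all_exists (P := fun i r => residue_system (P i) r)) => i.
  exact: residue_system_of_degree (fP i).
have D_neq0 := discriminant_neq0 degK sigmaP xiP DeltaP.
apply: iff_trans (supplementary_coprime Delta p_prime decomp hres D_neq0) _.
split=> [[a ha hDelta] j hcont|hncont].
  have [i fi] : exists i, f i = k j by apply/kP; exists j.
  rewrite -fi in hcont; apply: (hDelta i).
  exact: contains_divisor_system_vanish (hres i) hcont ha.
apply: (coprime_value_local hP hdist hres) => i.
have [j kj] : exists j, k j = f i by apply/kP; exists i.
apply: NNPP => hno; apply: (hncont j); rewrite kj.
apply: (vanish_contains_divisor_system (hP i) p_prime (hp i) (hres i)) => a ha.
by apply: NNPP => hna; apply: hno; exists a.
Qed.
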